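(* Let $ABC$ be a triangle and $P$ a point not on the extended sides of $ABC$ or of its anticomplementary triangle. If $P$ is ordinary and does not lie on a median of $ABC$ or on $\iota(l_\infty)$, the fixed point (center) of the map $\textsf{M}=T_P K^{-1} T_{P'}$ is $$S=OQ \cdot GV=OQ \cdot O'Q'.$$
   Context: We work in the Euclidean plane extended by the line at infinity $l_\infty$; points not on $l_\infty$ are ordinary; affine maps act on the extended plane; juxtaposition of maps is composition. Two lines are parallel if they meet $l_\infty$ in the same point. For lines $l,m$, $l\cdot m$ denotes their intersection point (possibly infinite). $ABC$ is a triangle with centroid $G$; $D_0,E_0,F_0$ are the midpoints of $BC,CA,AB$. $K$ is the complement map, the homothety with center $G$ and ratio $-1/2$; $K^{-1}(ABC)$ is the anticomplementary triangle. $P$ is a point not on the extended sides of $ABC$ or $K^{-1}(ABC)$. $D=AP\cdot BC$, $E=BP\cdot CA$, $F=CP\cdot AB$ are its traces. $D_3,E_3,F_3$ are the reflections of $D,E,F$ in $D_0,E_0,F_0$; the lines $AD_3,BE_3,CF_3$ concur in $P'=\iota(P)$, the isotomic conjugate of $P$ (in barycentric coordinates $\iota(x:y:z)=(1/x:1/y:1/z)$). $\iota(l_\infty)$ is the Steiner circumellipse. $Q=K(P')$, $Q'=K(P)$, $V=PQ\cdot P'Q'$. $T_P$ and $T_{P'}$ are the unique affine maps taking $A,B,C$ to $D,E,F$ and to $D_3,E_3,F_3$, respectively. The medians are the lines $AG,BG,CG$. The generalized circumcenter $O$ of $P$ is the point lying on the lines through $D_0,E_0,F_0$ parallel respectively to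 $QD,QE,QF$; equivalently $O=T_{P'}^{-1}K(Q)$. $O'$ is the generalized circumcenter of $P'$, i.e. $O'=T_P^{-1}K(Q')$. The map $\textsf{M}$ is a homothety or a translation; the center of a homothety is its ordinary fixed point, and the center of a translation is the point at infinity of its direction. *)

(* Defs.v *)
From mathcomp Require Import all_boot all_order all_algebra.
From mathcomp Require Import reals.

Set Implicit Arguments.
Unset Strict Implicit.
Unset Printing Implicit Defensive.

Import GRing.Theory.
Local Open Scope ring_scope.

(* The Euclidean plane is 'rV[R]_2.  The extended plane is the projective
   plane of R^(2+1): its points are the subspaces of dimension 1, its lines
   the subspaces of dimension 2, and incidence is inclusion.  For points
   X <> Y the line XY is (X + Y)%VS, and for lines l <> m the point l.m is
   (l :&: m)%VS. *)
Notation subspace R := {vspace 'rV[R]_(2 + 1)}.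

Definition is_point (R : realType) (X : subspace R) : Prop := \dim X = 1%N.

Definition is_line (R : realType) (l : subspace R) : Prop := \dim l = 2%N.

Definition pt (R : realType) (p : 'rV[R]_2) : subspace R :=
  <[row_mx p (1%:M : 'M_1)]>%VS.

Definition pt_inf (R : realType) (v : 'rV[R]_2) : subspace R :=
  <[row_mx v (0 : 'M_1)]>%VS.

Definition l_inf (R : realType) : subspace R :=
  lker (linfun (@rsubmx R 1 2 1)).

Definition ordinary (R : realType) (X : subspace R) : Prop :=
  is_point X /\ ~ (X <= l_inf R)%VS.

(* X = l.m, including that l and m really are two distinct lines. *)
Definition is_meet (R : realType) (X l m : subspace R) : Prop :=
  [/\ is_line l, is_line m, l <> m & X = (l :&: m)%VS].

Definition parallel (R : realType) (l m : subspace R) : Prop :=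
  exists X, is_meet X l (l_inf R) /\ is_meet X m (l_inf R).

Definition on_parallel_through (R : realType) (Z l X : subspace R) : Prop :=
  exists m, [/\ is_line m, parallel m l, (Z <= m)%VS & (X <= m)%VS].

(* The affine map p |-> p *m lin + trans (row vectors). *)
Record affine_map (R : realType) :=
  AffineMap { lin : 'M[R]_2; trans : 'rV[R]_2 }.

Definition aff_app (R : realType) (f : affine_map R) (p : 'rV[R]_2) :=
  p *m lin f + trans f.

(* Action on the extended plane: (v, t) |-> (v *m lin + t *: trans, t). *)
Definition aff_act (R : realType) (f : affine_map R) (X : subspace R)
    : subspace R :=
  (linfun (mulmxr (block_mx (lin f) 0 (trans f) 1%:M : 'M[R]_(2 + 1))) @: X)%VS.

(* f after g *)
Definition aff_comp (R : realType) (f g : affine_map R) : affine_map R :=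
  AffineMap (lin g *m lin f) (trans g *m lin f + trans f).

Definition aff_inv (R : realType) (f : affine_map R) : affine_map R :=
  AffineMap (invmx (lin f)) (- (trans f *m invmx (lin f))).

(* p |-> Z + k (p - Z) *)
Definition dilation (R : realType) (Z : 'rV[R]_2) (k : R) : affine_map R :=
  AffineMap k%:M ((1 - k) *: Z).

Definition translation (R : realType) (v : 'rV[R]_2) : affine_map R :=
  AffineMap 1%:M v.

Definition is_homothety (R : realType) (f : affine_map R) : Prop :=
  exists Z k, [/\ k != 0, k != 1 & f = dilation Z k].

Definition is_center (R : realType) (f : affine_map R) (S : subspace R)
    : Prop :=
  [/\ is_homothety f, ordinary S & aff_act f S = S] \/
  (exists v, [/\ v != 0, f = translation v & S = pt_inf v]).

Definition reflect_in (R : realType) (Z : 'rV[R]_2) (X : subspace R) :=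
  aff_act (dilation Z (-1)) X.

Definition midpoint (R : realType) (p q : 'rV[R]_2) : 'rV[R]_2 :=
  2^-1 *: (p + q).

Definition centroid (R : realType) (A B C : 'rV[R]_2) : 'rV[R]_2 :=
  3^-1 *: (A + B + C).

Definition complement_map (R : realType) (A B C : 'rV[R]_2) : affine_map R :=
  dilation (centroid A B C) (- 2^-1).

Definition triangle (R : realType) (A B C : 'rV[R]_2) : Prop :=
  ~ exists l, [/\ is_line l, (pt A <= l)%VS, (pt B <= l)%VS & (pt C <= l)%VS].

Definition off_sides (R : realType) (A B C : 'rV[R]_2) (P : subspace R)
    : Prop :=
  [/\ ~ (P <= pt B + pt C)%VS, ~ (P <= pt C + pt A)%VS
    & ~ (P <= pt A + pt B)%VS].

Definition off_medians (R : realType) (A B C : 'rV[R]_2) (P : subspace R)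
    : Prop :=
  let G := pt (centroid A B C) in
  [/\ ~ (P <= pt A + G)%VS, ~ (P <= pt B + G)%VS & ~ (P <= pt C + G)%VS].

(* The trace AP.BC of P on the side BC; the traces on CA and AB are
   trace B C A P and trace C A B P. *)
Definition trace (R : realType) (A B C : 'rV[R]_2) (P : subspace R)
    : subspace R :=
  ((pt A + P) :&: (pt B + pt C))%VS.

(* The trace on BC reflected in the midpoint of BC. *)
Definition refl_trace (R : realType) (A B C : 'rV[R]_2) (P : subspace R)
    : subspace R :=
  reflect_in (midpoint B C) (trace A B C P).

Definition is_isotomic_conjugate (R : realType) (A B C : 'rV[R]_2)
    (P P' : subspace R) : Prop :=
  [/\ is_point P', (P' <= pt A + refl_trace A B C P)%VS,
      (P' <= pt B + refl_trace B C A P)%VS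
    & (P' <= pt C + refl_trace C A B P)%VS].

(* The image of l_inf under isotomic conjugation.  When X is the infinite point
   of a side, is_isotomic_conjugate A B C X relates X exactly to the opposite
   vertex, so this is the whole ellipse. *)
Definition on_steiner_circumellipse (R : realType) (A B C : 'rV[R]_2)
    (P : subspace R) : Prop :=
  exists X, [/\ is_point X, (X <= l_inf R)%VS
              & is_isotomic_conjugate A B C X P].

(* O is on the lines through the midpoints of BC, CA, AB parallel to QD, QE, QF,
   where Q is the complement of the isotomic conjugate of P. *)
Definition is_generalized_circumcenter (R : realType) (A B C : 'rV[R]_2)
    (P O : subspace R) : Prop :=
  is_point O /\
  exists2 P', is_isotomic_conjugate A B C P P' &
    let Q := aff_act (complement_map A B C) P' in
    [/\ on_parallel_through (pt (midpoint B C)) (Q + trace A B C P)%VS O,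
        on_parallel_through (pt (midpoint C A)) (Q + trace B C A P)%VS O
      & on_parallel_through (pt (midpoint A B)) (Q + trace C A B P)%VS O].

Definition maps_triangle (R : realType) (T : affine_map R) (A B C : 'rV[R]_2)
    (X Y Z : subspace R) : Prop :=
  [/\ aff_act T (pt A) = X, aff_act T (pt B) = Y & aff_act T (pt C) = Z].

(* Main.v *)
Require Import Defs.
From mathcomp Require Import all_boot all_order all_algebra.
From mathcomp Require Import reals.
From mathcomp Require Import ring.

Set Implicit Arguments.
Unset Strict Implicit.
Unset Printing Implicit Defensive.

Import GRing.Theory Num.Theory.
Local Open Scope ring_scope.

(* Write P = (x : y : z) in barycentric coordinates, and let a = y + z,
   b = z + x, c = x + y, s = x + y + z, t = xy + yz + zx.  Then P' = (yz : ...),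
   Q = (xa : ...), Q' = (a : ...), and with S = (x a^2 : ...) the map M is
   X |-> -4xyz/(abc) X + S/(abc) on normalized coordinates, so S is its center
   whether or not M is a translation.  As coordinate triples,
   O = 2t S - abc Q, V = S - xyz (1 : 1 : 1), and O' is proportional to
   2s S - abc Q', which gives the three collinearities.  Every nondegeneracy
   condition reduces to the nonvanishing of x, y, z, a, b, c, s, t and of
   (x - y)(y - z)(z - x). *)

(** * Points, lines and affine maps of the extended plane in terms of vectors *)

Section Incidence.
Variable R : realType.
Implicit Types (X Y l m : subspace R) (u v : 'rV[R]_(2 + 1)).
Implicit Types (f g : affine_map R).

Lemma dim_plane : \dim {:'rV[R]_(2 + 1)} = 3%N.
Proof. by rewrite dimvf dim_matrix. Qed.

Lemma point_line u : u != 0 -> is_point <[u]>%VS.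
Proof. by rewrite /is_point dim_vline => ->. Qed.

(** A subspace of the one-dimensional X is 0 or X itself, and here the intersection with l cannot be
    X. *)
Lemma dim_add_point X l :
  is_point X -> ~ (X <= l)%VS -> \dim (l + X)%VS = (\dim l).+1.
Proof.
move=> dimX notXl; have := dimv_sum_cap l X.
suff ->: \dim (l :&: X) = 0%N by rewrite addn0 dimX => ->; exact: addn1.
apply/eqP; rewrite -leqn0 leqNgt; apply/negP => cap_gt0; apply: notXl.
have: (l :&: X)%VS == X by rewrite eqEdim capvSr dimX.
by move/eqP/capv_idPr.
Qed.

Lemma point_sub X Y : is_point X -> is_point Y -> (X <= Y)%VS -> X = Y.
Proof. by move=> dX dY sXY; apply/eqP; rewrite eqEdim sXY dX dY. Qed.

Lemma line_sub l m : is_line l -> is_line m -> (l <= m)%VS -> l = m.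
Proof. by move=> dl dm slm; apply/eqP; rewrite eqEdim slm dl dm. Qed.

Lemma line_add X Y : is_point X -> is_point Y -> X <> Y -> is_line (X + Y)%VS.
Proof.
move=> dX dY neqXY; rewrite /is_line dim_add_point ?dX // => sYX.
by apply: neqXY; apply: esym; apply: point_sub.
Qed.

Lemma line_joinE X Y l : is_point X -> is_point Y -> X <> Y -> is_line l ->
  (X <= l)%VS -> (Y <= l)%VS -> l = (X + Y)%VS.
Proof.
move=> dX dY neqXY dl sXl sYl; apply/esym/line_sub => //; first exact: line_add.
by rewrite subv_add sXl.
Qed.

(** If the intersection had dimension 2, both lines would equal it. So it has dimension at most 1,
    and any common point fills it. The traces, V and S are all identified this way. *)
Lemma meet_point X l m : is_line l -> is_line m -> l <> m -> is_point X ->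
  (X <= l)%VS -> (X <= m)%VS -> is_meet X l m.
Proof.
move=> dl dm neqlm dX sXl sXm; split=> //; apply/eqP.
rewrite eqEdim subv_cap sXl sXm dX /= leqNgt; apply/negP => cap_gt1.
apply: neqlm; apply: line_sub => //; apply/capv_idPl/eqP.
by rewrite eqEdim capvSl dl.
Qed.

Lemma line_through X Y : is_point X -> is_point Y ->
  exists l, [/\ is_line l, (X <= l)%VS & (Y <= l)%VS].
Proof.
move=> dX dY; have [sYX|/negP nsYX] := boolP (Y <= X)%VS; last first.
  exists (X + Y)%VS; split; rewrite ?addvSl ?addvSr //.
  by rewrite /is_line dim_add_point ?dX.
(* Now X = Y, and a second point is spanned by a vector outside X, available since the whole space
   has dimension 3. *)
have: (\dim X < \dim {:'rV[R]_(2 + 1)})%N by rewrite dX dim_plane.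
rewrite ltnNge => dimX; have [v _ vX]: exists2 v, v \in fullv & v \notin X.
  by apply/subvPn; apply: contra dimX => /dimvS.
have v_neq0: v != 0 by apply: contraNneq vX => ->; rewrite mem0v.
have vX': ~ (<[v]> <= X)%VS by rewrite -memvE; apply/negP.
exists (X + <[v]>)%VS; split; rewrite ?addvSl //.
  by rewrite /is_line dim_add_point ?dX //; apply: point_line.
by apply: subv_trans sYX _; rewrite addvSl.
Qed.

Lemma sub_join u v w (k h : R) : w = k *: u + h *: v ->
  (<[w]> <= <[u]> + <[v]>)%VS.
Proof. by move=> ->; rewrite -memvE memv_add ?memvZ ?memv_line. Qed.

Lemma joinP u v w :
  (<[w]> <= <[u]> + <[v]>)%VS -> exists k h, w = k *: u + h *: v.
Proof.
rewrite -memvE => /memv_addP[_ /vlineP[k ->] [_ /vlineP[h ->] ->]].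
by exists k, h.
Qed.

Lemma vline_scale u v k : k != 0 -> u = k *: v -> <[u]>%VS = <[v]>%VS.
Proof.
move=> k0 ->; apply/eqP; rewrite eqEsubv -!memvE memvZ ?memv_line //=.
by apply/vlineP; exists k^-1; rewrite scalerA mulVf ?scale1r.
Qed.

Lemma point_vline X : is_point X -> exists2 u, u != 0 & X = <[u]>%VS.
Proof.
move=> dX; exists (vpick X); first by rewrite vpick0 -dimv_eq0 dX.
apply/esym/point_sub => //; last by rewrite -memvE memv_pick.
by apply: point_line; rewrite vpick0 -dimv_eq0 dX.
Qed.

(** The last homogeneous coordinate: 0 for points at infinity, 1 for the normalized representatives
    [homog p]. Affine maps preserve it. *)
Definition weight v : R := v 0 (rshift 2 0).

Lemma weightD u v : weight (u + v) = weight u + weight v.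
Proof. by rewrite /weight mxE. Qed.

Lemma weightZ k v : weight (k *: v) = k * weight v.
Proof. by rewrite /weight mxE. Qed.

Definition homog (p : 'rV[R]_2) : 'rV[R]_(2 + 1) := row_mx p (1%:M : 'M_1).

Lemma weight_homog p : weight (homog p) = 1.
Proof. by rewrite /weight row_mxEr mxE. Qed.

Lemma homog_neq0 p : homog p != 0.
Proof.
apply: contraTneq (oner_neq0 R) => /(congr1 weight).
by rewrite weight_homog /weight mxE => ->; rewrite eqxx.
Qed.

Lemma rsubmx_weight v : rsubmx v = (weight v)%:M.
Proof. by rewrite [LHS]mx11_scalar mxE. Qed.

Lemma homog_lsubmx v : weight v = 1 -> v = homog (lsubmx v).
Proof. by move=> wv; rewrite -[LHS]hsubmxK rsubmx_weight wv. Qed.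

Lemma inf_lsubmx v : weight v = 0 -> v = row_mx (lsubmx v) (0 : 'M_1).
Proof. by move=> wv; rewrite -[LHS]hsubmxK rsubmx_weight wv raddf0. Qed.

Lemma sub_l_inf v : (<[v]> <= l_inf R)%VS = (weight v == 0).
Proof.
rewrite -memvE memv_ker lfunE /= rsubmx_weight.
apply/eqP/eqP => [/matrixP/(_ 0 0)|->]; last exact: raddf0.
by rewrite !mxE eqxx mulr1n.
Qed.

Definition aff_mx f : 'M[R]_(2 + 1) := block_mx (lin f) 0 (trans f) 1%:M.

Lemma aff_act_line f v : aff_act f <[v]>%VS = <[v *m aff_mx f]>%VS.
Proof. by rewrite /aff_act limg_line lfunE. Qed.

Lemma homog_aff f p : homog p *m aff_mx f = homog (aff_app f p).
Proof. by rewrite mul_row_block mulmx0 add0r !mul1mx. Qed.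

Lemma weight_aff f v : weight (v *m aff_mx f) = weight v.
Proof.
rewrite -[v]hsubmxK mul_row_block mulmx0 add0r mulmx1.
by rewrite /weight !row_mxEr.
Qed.

Lemma aff_mx_comp f g : aff_mx (aff_comp f g) = aff_mx g *m aff_mx f.
Proof.
by rewrite /aff_mx mulmx_block !mul0mx !mulmx0 !mul1mx !addr0 !add0r.
Qed.

Lemma aff_mx_inj f g : aff_mx f = aff_mx g -> f = g.
Proof. by case: f g => [a b] [c d] /eq_block_mx[/= -> _ -> _]. Qed.

(** The shape, a multiple of v plus [weight v] times a fixed vector, is the one in which
    [center_sub] recognizes homotheties and translations. *)
Lemma dilation_aff Z k v : v *m aff_mx (dilation Z k) =
  k *: v + (weight v * (1 - k)) *: homog Z.
Proof.
rewrite -[v]hsubmxK mul_row_block mulmx0 add0r mulmx1 rsubmx_weight /=.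
rewrite mul_scalar_mx scalerA mul_mx_scalar /homog !scale_row_mx add_row_mx.
rewrite /weight row_mxEr mxE eqxx mulr1n; congr row_mx.
by rewrite !scale_scalar_mx -raddfD /=; congr _%:M; ring.
Qed.

Lemma translation_aff t v :
  v *m aff_mx (translation t) = v + weight v *: row_mx t 0.
Proof.
rewrite -[v]hsubmxK mul_row_block mulmx0 add0r mulmx1 rsubmx_weight /=.
rewrite mul_scalar_mx mulmx1 !scale_row_mx add_row_mx.
by rewrite /weight row_mxEr mxE eqxx mulr1n scaler0 addr0.
Qed.

End Incidence.

(** * Barycentric coordinates with respect to a triangle *)

Section Barycentric.
Variable R : realType.
Implicit Types (A B C : 'rV[R]_2) (P X Y l m : subspace R) (f : affine_map R).
Implicit Types (x y z : R).

(** A vector rather than a point, so that linear relations between coordinate triples directly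
    witness incidences. *)
Definition bary A B C x y z : 'rV[R]_(2 + 1) :=
  x *: homog A + y *: homog B + z *: homog C.

(** Rotating vertices and coordinates together transfers statements about BC to CA and AB. *)
Lemma bary_rot A B C x y z : bary A B C x y z = bary B C A y z x.
Proof. by rewrite /bary -addrA addrC. Qed.

Lemma baryD A B C x y z x' y' z' : bary A B C x y z + bary A B C x' y' z' =
  bary A B C (x + x') (y + y') (z + z').
Proof. by rewrite /bary !scalerDl addrACA [X in X + _]addrACA. Qed.

Lemma baryZ A B C k x y z :
  k *: bary A B C x y z = bary A B C (k * x) (k * y) (k * z).
Proof. by rewrite /bary !scalerDr !scalerA. Qed.

Lemma weight_bary A B C x y z : weight (bary A B C x y z) = x + y + z.
Proof. by rewrite /bary !weightD !weightZ !weight_homog !mulr1. Qed.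

Lemma bary1 A B C : homog A = bary A B C 1 0 0.
Proof. by rewrite /bary !scale0r !addr0 scale1r. Qed.

Lemma bary2 A B C : homog B = bary A B C 0 1 0.
Proof. by rewrite /bary !scale0r addr0 add0r scale1r. Qed.

Lemma bary3 A B C : homog C = bary A B C 0 0 1.
Proof. by rewrite /bary !scale0r !add0r scale1r. Qed.

Lemma bary_homog A B C x y z : x + y + z = 1 ->
  homog (x *: A + y *: B + z *: C) = bary A B C x y z.
Proof.
move=> sum1; rewrite /bary /homog !scale_row_mx !add_row_mx; congr row_mx.
by rewrite !scale_scalar_mx -!raddfD /= !mulr1 sum1.
Qed.

Lemma bary_centroid A B C :
  homog (centroid A B C) = bary A B C 3^-1 3^-1 3^-1.
Proof. by rewrite /centroid !scalerDr bary_homog //; field. Qed.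

Lemma bary_midpoint A B C : homog (midpoint B C) = bary A B C 0 2^-1 2^-1.
Proof.
rewrite -bary_homog; last by field.
by rewrite /midpoint scalerDr scale0r add0r.
Qed.

Lemma bary_aff A B C x y z f : bary A B C x y z *m aff_mx f =
  x *: homog (aff_app f A) + y *: homog (aff_app f B)
    + z *: homog (aff_app f C).
Proof. by rewrite /bary !mulmxDl -!scalemxAl !homog_aff. Qed.

Lemma triangle_rot A B C : triangle A B C -> triangle B C A.
Proof. by move=> tri [l [dl B_l C_l A_l]]; apply: tri; exists l. Qed.

Lemma point_pt A : is_point (pt A).
Proof. exact: point_line (homog_neq0 A). Qed.

Section Triangle.
Variables (A B C : 'rV[R]_2).
Hypothesis tri : triangle A B C.
Local Notation w := (bary A B C).

Lemma triangle_neq : pt A <> pt B.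
Proof.
move=> eqAB; apply: tri.
have [l [dl A_l C_l]] := line_through (point_pt A) (point_pt C).
by exists l; split; rewrite -?eqAB.
Qed.

Lemma triangle_notin : ~ (pt C <= pt A + pt B)%VS.
Proof.
move=> C_AB; apply: tri; exists (pt A + pt B)%VS; split=> //.
- exact: line_add (point_pt A) (point_pt B) triangle_neq.
- exact: addvSl.
- exact: addvSr.
Qed.

Lemma triangle_full : (pt A + pt B + pt C)%VS = fullv.
Proof.
apply/eqP; rewrite eqEdim subvf dim_plane dim_add_point //.
- by rewrite (line_add (point_pt A) (point_pt B) triangle_neq).
- exact: point_pt.
- exact: triangle_notin.
Qed.

(** A relation with z nonzero would put C on AB. Once z = 0, the weights give x = -y, and a nonzero
    y would force A = B. *)
Lemma bary_eq0 x y z : w x y z = 0 -> [/\ x = 0, y = 0 & z = 0].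
Proof.
move=> w0; have sum0: x + y + z = 0.
  by rewrite -(weight_bary A B C) w0 /weight mxE.
have z0: z = 0.
  apply/eqP/negP => /negP z0; apply: triangle_notin.
  apply: (@sub_join _ _ _ _ (- (z^-1 * x)) (- (z^-1 * y))).
  rewrite -/(homog A) -/(homog B) -/(homog C).
  have zC: z *: homog C = - (x *: homog A + y *: homog B).
    by apply/eqP; rewrite -addr_eq0 addrC; apply/eqP.
  by rewrite -[LHS](scalerK z0) zC scalerN scalerDr !scalerA opprD -!scaleNr.
move: w0 sum0; rewrite z0 /bary scale0r !addr0 => w0 /eqP.
rewrite addr_eq0 => /eqP xE; have y0: y = 0.
  apply/eqP/negP => /negP y0; apply: triangle_neq.
  apply: (@vline_scale _ _ _ 1); first exact: oner_neq0.
  apply: (scalerI y0); rewrite scale1r -/(homog A) -/(homog B).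
  by apply/eqP; rewrite -subr_eq0 -oppr_eq0 opprB addrC -scaleNr -xE w0.
by rewrite xE y0 oppr0.
Qed.

Lemma bary_inj x y z x' y' z' :
  w x y z = w x' y' z' -> [/\ x = x', y = y' & z = z'].
Proof.
move=> /eqP; rewrite -subr_eq0 -scaleN1r baryZ baryD => /eqP/bary_eq0.
by rewrite !mulN1r => -[/subr0_eq-> /subr0_eq-> /subr0_eq->].
Qed.

Lemma bary_surj v : exists x y z, v = w x y z.
Proof.
have: v \in (pt A + pt B + pt C)%VS by rewrite triangle_full memvf.
case/memv_addP => _ /memv_addP[_ /vlineP[x ->] [_ /vlineP[y ->] ->]].
by case=> _ /vlineP[z ->] ->; exists x, y, z.
Qed.

Lemma point_bary x y z :
  [|| x != 0, y != 0 | z != 0] -> is_point <[w x y z]>%VS.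
Proof.
move=> nz; apply: point_line; apply: contraTneq nz => /bary_eq0[-> -> ->].
by rewrite eqxx.
Qed.

(** Proportional triples have vanishing 2 x 2 minors. Later, points are shown distinct by factoring
    a minor into nonzero terms. *)
Lemma eq_point_bary x y z x' y' z' : <[w x y z]>%VS = <[w x' y' z']>%VS ->
  [/\ x * y' = y * x', y * z' = z * y' & z * x' = x * z'].
Proof.
move=> eqw; have: w x y z \in <[w x' y' z']>%VS by rewrite -eqw memv_line.
by case/vlineP=> k; rewrite baryZ => /bary_inj[-> -> ->]; split; ring.
Qed.

(** The left side of the conclusion is the determinant of the three triples. Its contrapositive
    later separates lines: a nonzero determinant puts a point of one line off the other. *)
Lemma sub_join_bary x1 x2 x3 y1 y2 y3 z1 z2 z3 :
  (<[w z1 z2 z3]> <= <[w x1 x2 x3]> + <[w y1 y2 y3]>)%VS ->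
  x1 * (y2 * z3 - y3 * z2) + x2 * (y3 * z1 - y1 * z3)
    + x3 * (y1 * z2 - y2 * z1) = 0.
Proof.
by move=> /joinP[k [h]]; rewrite !baryZ baryD => /bary_inj[-> -> ->]; ring.
Qed.

End Triangle.
End Barycentric.

(** * Coordinates of traces, reflected traces and isotomic conjugates *)

Section Traces.
Variable R : realType.
Implicit Types (A B C : 'rV[R]_2) (P X Y l m : subspace R) (f : affine_map R).
Implicit Types (x y z : R).

Lemma line_side A B C : triangle A B C -> is_line (pt B + pt C)%VS.
Proof.
move=> /triangle_rot/triangle_neq neqBC.
by apply: line_add neqBC; apply: point_pt.
Qed.

Lemma trace_bary A B C x y z : triangle A B C -> x != 0 -> y != 0 ->
  trace A B C <[bary A B C x y z]>%VS = <[bary A B C 0 y z]>%VS.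
Proof.
move=> tri x0 y0; apply/esym.
suff []: is_meet <[bary A B C 0 y z]>%VS
  (pt A + <[bary A B C x y z]>)%VS (pt B + pt C)%VS by [].
apply: meet_point.
- apply: line_add; [exact: point_pt|by apply: point_bary; rewrite ?x0|].
  rewrite {1}/pt -/(homog A) (bary1 A B C) => /(eq_point_bary tri)[+ _ _].
  by move/eqP; rewrite mul0r mul1r (negbTE y0).
- exact: line_side tri.
- move=> eql; have: (pt A <= pt B + pt C)%VS by rewrite -eql addvSl.
  exact/triangle_notin/triangle_rot.
- by apply: point_bary; rewrite ?y0 ?orbT.
(* Subtracting x A from the vector of P leaves (0, y, z). *)
- apply: (@sub_join _ _ _ _ (- x) 1); rewrite -/(homog A) (bary1 A B C).
  by rewrite !baryZ baryD; congr bary; ring.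
- apply: (@sub_join _ _ _ _ y z).
  rewrite -/(homog B) -/(homog C) (bary2 A B C) (bary3 A B C).
  by rewrite !baryZ baryD; congr bary; ring.
Qed.

Lemma refl_trace_bary A B C x y z : triangle A B C -> x != 0 -> y != 0 ->
  refl_trace A B C <[bary A B C x y z]>%VS = <[bary A B C 0 z y]>%VS.
Proof.
move=> tri x0 y0; rewrite /refl_trace /reflect_in trace_bary //.
rewrite aff_act_line dilation_aff weight_bary (bary_midpoint A).
by rewrite !baryZ baryD; congr (<[bary _ _ _ _ _ _]>)%VS; field.
Qed.

Lemma trace_bary2 A B C x y z : triangle A B C -> y != 0 -> z != 0 ->
  trace B C A <[bary A B C x y z]>%VS = <[bary A B C x 0 z]>%VS.
Proof.
move=> /triangle_rot tri y0 z0.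
by rewrite bary_rot trace_bary // -bary_rot.
Qed.

Lemma trace_bary3 A B C x y z : triangle A B C -> z != 0 -> x != 0 ->
  trace C A B <[bary A B C x y z]>%VS = <[bary A B C x y 0]>%VS.
Proof.
move=> tri z0 x0; rewrite bary_rot trace_bary2 //; last exact: triangle_rot.
by rewrite -bary_rot.
Qed.

Lemma refl_trace_bary2 A B C x y z : triangle A B C -> y != 0 -> z != 0 ->
  refl_trace B C A <[bary A B C x y z]>%VS = <[bary A B C z 0 x]>%VS.
Proof.
move=> /triangle_rot tri y0 z0.
by rewrite bary_rot refl_trace_bary // -bary_rot.
Qed.

Lemma refl_trace_bary3 A B C x y z : triangle A B C -> z != 0 -> x != 0 ->
  refl_trace C A B <[bary A B C x y z]>%VS = <[bary A B C y x 0]>%VS.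
Proof.
move=> /triangle_rot tri z0 x0; rewrite bary_rot refl_trace_bary2 //.
by rewrite -bary_rot.
Qed.

Lemma isotomic_bary A B C x y z : triangle A B C ->
  x != 0 -> y != 0 -> z != 0 ->
  is_isotomic_conjugate A B C <[bary A B C x y z]>%VS
    <[bary A B C (y * z) (z * x) (x * y)]>%VS.
Proof.
move=> tri x0 y0 z0; split.
- by apply: point_bary; rewrite // mulf_neq0.
- rewrite refl_trace_bary //; apply: (@sub_join _ _ _ _ (y * z) x).
  by rewrite -/(homog A) (bary1 A B C) !baryZ baryD; congr bary; ring.
- rewrite refl_trace_bary2 //; apply: (@sub_join _ _ _ _ (z * x) y).
  by rewrite -/(homog B) (bary2 A B C) !baryZ baryD; congr bary; ring.
- rewrite refl_trace_bary3 //; apply: (@sub_join _ _ _ _ (x * y) z).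
  by rewrite -/(homog C) (bary3 A B C) !baryZ baryD; congr bary; ring.
Qed.

Lemma isotomic_unique A B C x y z X : triangle A B C ->
  x != 0 -> y != 0 -> z != 0 ->
  is_isotomic_conjugate A B C <[bary A B C x y z]>%VS X ->
  X = <[bary A B C (y * z) (z * x) (x * y)]>%VS.
Proof.
move=> tri x0 y0 z0 [/point_vline[u u0 ->]].
have [p [q [r uE]]] := bary_surj tri u; rewrite {}uE in u0 *.
rewrite refl_trace_bary // refl_trace_bary2 // refl_trace_bary3 //.
rewrite /pt -/(homog A) -/(homog B) (bary1 A B C) (bary2 A B C).
move=> /(sub_join_bary tri) eq1 /(sub_join_bary tri) eq2 _.
(* The determinants for the lines through A and B give q y = z r and p x = z r, so (p, q, r) is
   r/(xy) times (yz, zx, xy). *)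
have qE: q = z * r / y.
  apply: (mulIf y0); rewrite divfK //; apply/eqP.
  by rewrite -subr_eq0 -oppr_eq0 -eq1; apply/eqP; ring.
have pE: p = z * r / x.
  apply: (mulIf x0); rewrite divfK //; apply/eqP.
  by rewrite -subr_eq0 -eq2; apply/eqP; ring.
have r0: r / (x * y) != 0.
  apply: contraNneq u0 => /(canRL (divfK (mulf_neq0 x0 y0))).
  rewrite qE pE mul0r => ->; rewrite !mulr0 !mul0r.
  by rewrite /bary !scale0r !addr0.
apply: (vline_scale r0); rewrite baryZ qE pE.
by congr bary; field; rewrite ?x0 ?y0.
Qed.

End Traces.

(** * The generalized circumcenter in coordinates *)

Section Circumcenter.
Variable R : realType.
Implicit Types (A B C : 'rV[R]_2) (P X Y l m O : subspace R) (f : affine_map R).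
Implicit Types (x y z : R) (u v : 'rV[R]_(2 + 1)).

Lemma point_weight u : weight u != 0 -> is_point <[u]>%VS.
Proof.
move=> wu; apply: point_line; apply: contraNneq wu => ->.
by rewrite /weight mxE.
Qed.

(** The first coordinate of 2t S - abc Q, with x a factored out; cyclic shifts give the other
    two. *)
Definition circumcenter_coord x y z :=
  x * (y + z) * (2 * (x * y + y * z + z * x) * (y + z)
    - (y + z) * (z + x) * (x + y)).

Definition circumcenter_bary A B C x y z := bary A B C
  (circumcenter_coord x y z) (circumcenter_coord y z x)
  (circumcenter_coord z x y).

(** The combination of u and v in the conclusion has weight 0, so it represents the point at
    infinity of their join, which every parallel line shares. *)
Lemma parallel_throughP X u v l : on_parallel_through X (<[u]> + <[v]>)%VS l ->
  exists m, [/\ is_line m, (X <= m)%VS, (l <= m)%VS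
              & weight v *: u - weight u *: v \in m].
Proof.
move=> [m [dm [Y [[_ _ _ Ym] [_ _ _ Yl]]] sXm slm]]; exists m; split=> //.
have: weight v *: u - weight u *: v \in Y.
  rewrite Yl memv_cap -scaleNr memv_add ?memvZ ?memv_line //= memvE sub_l_inf.
  by rewrite weightD !weightZ; apply/eqP; ring.
by rewrite Ym memv_cap => /andP[].
Qed.

Lemma parallel_through_midpoint A B C x y z X : triangle A B C ->
  on_parallel_through (pt (midpoint B C))
    (<[bary A B C (x * (y + z)) (y * (z + x)) (z * (x + y))]>
       + <[bary A B C 0 y z]>)%VS X ->
  exists m, [/\ is_line m, (pt (midpoint B C) <= m)%VS, (X <= m)%VS
    & (<[circumcenter_bary A B C x y z]> <= m)%VS].
Proof.
move=> tri /parallel_throughP[m [dm D0m sXm vm]]; exists m; split=> //.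
(* The circumcenter vector is sought as 2h D0 plus k times the direction of QD. The first coordinate
   of D0 is 0 and that of the direction is x a^2, so k = 2t - bc = t - x^2. The second coordinate
   then determines h, and the third agrees identically. *)
pose k := x * y + y * z + z * x - x ^+ 2.
pose h := (z + x) * (2 * (x * y + y * z + z * x) * (z + x)
    - (y + z) * (z + x) * (x + y)) * y
  - k * y * ((y + z) * (z + x) - 2 * (x * y + y * z + z * x)).
have -> : circumcenter_bary A B C x y z = (2 * h) *: homog (midpoint B C) +
  k *: (weight (bary A B C 0 y z)
          *: bary A B C (x * (y + z)) (y * (z + x)) (z * (x + y))
        - weight (bary A B C (x * (y + z)) (y * (z + x)) (z * (x + y)))
          *: bary A B C 0 y z).
  rewrite (bary_midpoint A) !weight_bary -scaleN1r !(baryZ, baryD).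
  by rewrite /circumcenter_bary /circumcenter_coord /h /k; congr bary; field.
by rewrite -memvE memvD ?memvZ // memvE.
Qed.

(** The weight is nonzero when xyz and t are, so the triple then represents an ordinary point. *)
Lemma weight_circumcenter A B C x y z : weight (circumcenter_bary A B C x y z) =
  8 * (x * y + y * z + z * x) * (x * y * z).
Proof. by rewrite weight_bary /circumcenter_coord; ring. Qed.

Lemma complement_bary A B C x y z : aff_act (complement_map A B C)
  <[bary A B C x y z]>%VS = <[bary A B C (y + z) (z + x) (x + y)]>%VS.
Proof.
rewrite aff_act_line dilation_aff weight_bary bary_centroid baryZ baryZ baryD.
apply: (@vline_scale _ _ _ 2^-1); first by rewrite invr_eq0 pnatr_eq0.
by rewrite baryZ; congr bary; field.
Qed.

Lemma circumcenter_rot A B C x y z :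
  circumcenter_bary A B C x y z = circumcenter_bary B C A y z x.
Proof. exact: bary_rot. Qed.

(* Two distinct candidates would make the three lines coincide, and that line
   would contain the medial triangle. *)
Lemma circumcenterE A B C x y z O : triangle A B C ->
  x != 0 -> y != 0 -> z != 0 -> x * y + y * z + z * x != 0 ->
  is_generalized_circumcenter A B C <[bary A B C x y z]>%VS O ->
  O = <[circumcenter_bary A B C x y z]>%VS.
Proof.
move=> tri x0 y0 z0 sig0 [dO [_ /(isotomic_unique tri x0 y0 z0)-> /=]].
rewrite complement_bary trace_bary // trace_bary2 // trace_bary3 //.
have -> : bary A B C (z * x + x * y) (x * y + y * z) (y * z + z * x) =
    bary A B C (x * (y + z)) (y * (z + x)) (z * (x + y)) by congr bary; ring.
case=> /(parallel_through_midpoint tri)[m1 [dm1 D0m Om1 cm1]] par2 par3.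
(* Relabelling turns the conditions at E0 and F0 into the one at D0 for the triangles BCA and
   CAB. *)
rewrite 2!(@bary_rot _ A B C) in par2; rewrite 2!(@bary_rot _ A B C) in par3.
rewrite 2!(@bary_rot _ B C A) in par3.
have triB := triangle_rot tri; have triC := triangle_rot triB.
have [m2 [dm2 E0m Om2 cm2]] := parallel_through_midpoint triB par2.
have [m3 [dm3 F0m Om3 cm3]] := parallel_through_midpoint triC par3.
rewrite -circumcenter_rot in cm2; rewrite -2!circumcenter_rot in cm3.
have dc: is_point <[circumcenter_bary A B C x y z]>%VS.
  apply: point_weight; rewrite weight_circumcenter.
  by rewrite !mulf_neq0 ?pnatr_eq0.
apply/eqP/negP => /negP/eqP neqO; apply: tri.
have m1E := line_joinE dO dc neqO dm1 Om1 cm1.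
have m2E := line_joinE dO dc neqO dm2 Om2 cm2.
have m3E := line_joinE dO dc neqO dm3 Om3 cm3.
rewrite m2E -m1E -memvE -/(homog _) (bary_midpoint B) -bary_rot in E0m.
rewrite m3E -m1E -memvE -/(homog _) (bary_midpoint C) -2!bary_rot in F0m.
rewrite -memvE -/(homog _) (bary_midpoint A) in D0m.
(* The common line contains D0, E0 and F0, hence also A = E0 + F0 - D0 and likewise B and C. *)
exists m1; split=> //; rewrite -memvE -/(homog _).
- have -> : homog A = bary A B C 2^-1 0 2^-1 + bary A B C 2^-1 2^-1 0
      - bary A B C 0 2^-1 2^-1.
    by rewrite (bary1 A B C) -scaleN1r baryZ !baryD; congr bary; field.
  by apply: memvB => //; apply: memvD.
- have -> : homog B = bary A B C 2^-1 2^-1 0 + bary A B C 0 2^-1 2^-1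
      - bary A B C 2^-1 0 2^-1.
    by rewrite (bary2 A B C) -scaleN1r baryZ !baryD; congr bary; field.
  by apply: memvB => //; apply: memvD.
- have -> : homog C = bary A B C 2^-1 0 2^-1 + bary A B C 0 2^-1 2^-1
      - bary A B C 2^-1 2^-1 0.
    by rewrite (bary3 A B C) -scaleN1r baryZ !baryD; congr bary; field.
  by apply: memvB => //; apply: memvD.
Qed.

(** * Affine maps in barycentric coordinates and the formula for M *)

Lemma homog_aff_app f p u : weight u != 0 -> aff_act f (pt p) = <[u]>%VS ->
  homog (aff_app f p) = (weight u)^-1 *: u.
Proof.
move=> wu; rewrite aff_act_line -/(homog p) homog_aff => eqfp.
have /vlineP[k fpE]: homog (aff_app f p) \in <[u]>%VS.
  by rewrite -eqfp memv_line.
(* The image of a normalized vector has weight 1, which fixes the scalar k. *)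
rewrite fpE; congr (_ *: _); apply: (mulIf wu); rewrite mulVf //.
by rewrite -weightZ -fpE weight_homog.
Qed.

Lemma aff_inv_dilation (Z : 'rV[R]_2) (k : R) :
  k != 0 -> aff_inv (dilation Z k) = dilation Z k^-1.
Proof.
move=> k0; rewrite /aff_inv /dilation /= invmx_scalar mul_mx_scalar scalerA.
by rewrite -scaleNr; congr (AffineMap _ (_ *: _)); field.
Qed.

Lemma anticomplement_bary A B C x y z :
  bary A B C x y z *m aff_mx (aff_inv (complement_map A B C)) =
  bary A B C (y + z - x) (z + x - y) (x + y - z).
Proof.
have half0: - 2^-1 != 0 :> R by rewrite oppr_eq0 invr_eq0 pnatr_eq0.
rewrite aff_inv_dilation // dilation_aff weight_bary bary_centroid !baryZ baryD.
by congr bary; field.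
Qed.

(** Preservation of weight forces weight u = 1 - k, so u is fixed: k u + (1 - k) u = u. For k = 1 it
    has weight 0 and f is the translation along it; otherwise u/(1 - k) is normalized and is the
    center of a homothety of ratio k. *)
Lemma center_sub f k u : (forall v, v *m aff_mx f = k *: v + weight v *: u) ->
  k != 0 -> u != 0 -> is_center f <[u]>%VS.
Proof.
move=> fE k0 u0; have wu: weight u = 1 - k.
  have := weight_aff f (homog 0); rewrite fE weightD !weightZ weight_homog.
  by rewrite mulr1 mul1r => <-; rewrite addrC addKr.
have aff_ext g : (forall v, v *m aff_mx g = k *: v + weight v *: u) -> f = g.
  by move=> gE; apply/aff_mx_inj/row_matrixP => i; rewrite !rowE fE gE.
have [k1|k1] := eqVneq k 1.
  right; have uE := @inf_lsubmx _ u; rewrite wu k1 subrr in uE.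
  exists (lsubmx u); split; last by rewrite /pt_inf -uE.
    by apply: contraNneq u0 => u'0; rewrite uE // u'0 row_mx0.
  apply: aff_ext => v; rewrite translation_aff -uE // k1 scale1r //.
have k1': 1 - k != 0 by rewrite subr_eq0 eq_sym.
left; split.
- have ZE := @homog_lsubmx _ ((1 - k)^-1 *: u).
  rewrite weightZ wu mulVf // in ZE.
  exists (lsubmx ((1 - k)^-1 *: u)), k; split=> //.
  by apply: aff_ext => v; rewrite dilation_aff -ZE // scalerA mulfK.
- split; first exact: point_line.
  by rewrite sub_l_inf wu; apply/negP.
- by rewrite aff_act_line fE wu -scalerDl addrC subrK scale1r.
Qed.

Lemma cevian_map_bary A B C x y z f : triangle A B C ->
  x != 0 -> y != 0 -> z != 0 -> y + z != 0 -> z + x != 0 -> x + y != 0 ->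
  maps_triangle f A B C <[bary A B C 0 y z]>%VS <[bary A B C x 0 z]>%VS
    <[bary A B C x y 0]>%VS ->
  forall p q r, bary A B C p q r *m aff_mx f =
    bary A B C (q * x / (z + x) + r * x / (x + y))
      (p * y / (y + z) + r * y / (x + y)) (p * z / (y + z) + q * z / (z + x)).
Proof.
move=> tri x0 y0 z0 a0 b0 c0 [fA fB fC] p q r; rewrite bary_aff.
have wA : weight (bary A B C 0 y z) = y + z by rewrite weight_bary; ring.
have wB : weight (bary A B C x 0 z) = z + x by rewrite weight_bary; ring.
have wC : weight (bary A B C x y 0) = x + y by rewrite weight_bary; ring.
rewrite (homog_aff_app _ fA) ?wA // (homog_aff_app _ fB) ?wB //.
rewrite (homog_aff_app _ fC) ?wC // !(baryZ, baryD).
by congr bary; field; rewrite ?a0 ?b0 ?c0.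
Qed.

(** M sends A to (x(y - z)^2, y(z + x)^2, z(x + y)^2)/d. Since (y - z)^2 = (y + z)^2 - 4yz, this is
    S/d with 4xyz/d subtracted from the first coordinate, and similarly for B and C. *)
Lemma cevian_product_bary A B C x y z TP TP' : triangle A B C ->
  x != 0 -> y != 0 -> z != 0 -> y + z != 0 -> z + x != 0 -> x + y != 0 ->
  maps_triangle TP A B C <[bary A B C 0 y z]>%VS <[bary A B C x 0 z]>%VS
    <[bary A B C x y 0]>%VS ->
  maps_triangle TP' A B C <[bary A B C 0 z y]>%VS <[bary A B C z 0 x]>%VS
    <[bary A B C y x 0]>%VS ->
  let d := (y + z) * (z + x) * (x + y) in
  forall v, v *m aff_mx (aff_comp TP
      (aff_comp (aff_inv (complement_map A B C)) TP')) =
    (- 4 * (x * y * z) / d) *: v + weight v *: (d^-1 *: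
      bary A B C (x * (y + z) ^+ 2) (y * (z + x) ^+ 2) (z * (x + y) ^+ 2)).
Proof.
move=> tri x0 y0 z0 a0 b0 c0 TPs [TPA TPB TPC] d v.
have [p [q [r ->]]] := bary_surj tri v.
rewrite !aff_mx_comp !mulmxA bary_aff.
have wA : weight (bary A B C 0 z y) = y + z by rewrite weight_bary; ring.
have wB : weight (bary A B C z 0 x) = z + x by rewrite weight_bary; ring.
have wC : weight (bary A B C y x 0) = x + y by rewrite weight_bary; ring.
rewrite (homog_aff_app _ TPA) ?wA // (homog_aff_app _ TPB) ?wB //.
rewrite (homog_aff_app _ TPC) ?wC //.
rewrite !(baryZ, baryD) anticomplement_bary.
rewrite (cevian_map_bary tri _ _ _ _ _ _ TPs) //.
by rewrite /d weight_bary; congr bary; field; rewrite ?a0 ?b0 ?c0.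
Qed.

(** * The nondegeneracy hypotheses as nonvanishing conditions on coordinates *)

Lemma off_sides_bary A B C x y z : off_sides A B C <[bary A B C x y z]>%VS ->
  [/\ x != 0, y != 0 & z != 0].
Proof.
case=> offBC offCA offAB; split.
- apply: contra_notN offBC => /eqP x0; apply: (@sub_join _ _ _ _ y z).
  by rewrite x0 /bary scale0r add0r.
- apply: contra_notN offCA => /eqP y0; apply: (@sub_join _ _ _ _ z x).
  by rewrite y0 /bary scale0r addr0 addrC.
- apply: contra_notN offAB => /eqP z0; apply: (@sub_join _ _ _ _ x y).
  by rewrite z0 /bary scale0r addr0.
Qed.

(** The anticomplementary vertices are (-1 : 1 : 1) and its cyclic shifts, so their joins are the
    lines y + z = 0, z + x = 0 and x + y = 0. *)
Lemma off_anticomplementary_bary A B C x y z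
    (K := complement_map A B C) :
  off_sides (aff_app (aff_inv K) A) (aff_app (aff_inv K) B)
    (aff_app (aff_inv K) C) <[bary A B C x y z]>%VS ->
  [/\ y + z != 0, z + x != 0 & x + y != 0].
Proof.
have eqA : homog (aff_app (aff_inv K) A) = bary A B C (-1) 1 1.
  rewrite -homog_aff (bary1 A B C) anticomplement_bary.
  by congr bary; ring.
have eqB : homog (aff_app (aff_inv K) B) = bary A B C 1 (-1) 1.
  rewrite -homog_aff (bary2 A B C) anticomplement_bary.
  by congr bary; ring.
have eqC : homog (aff_app (aff_inv K) C) = bary A B C 1 1 (-1).
  rewrite -homog_aff (bary3 A B C) anticomplement_bary.
  by congr bary; ring.
rewrite /off_sides /pt -!/(homog (aff_app _ A)) -!/(homog (aff_app _ B)).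
rewrite -!/(homog (aff_app _ C)) eqA eqB eqC.
case=> offBC offCA offAB; split.
- apply: contra_notN offBC; rewrite addr_eq0 => /eqP yE.
  apply: (@sub_join _ _ _ _ ((x + z) / 2) ((x - z) / 2)).
  by rewrite !baryZ baryD yE; congr bary; field.
- apply: contra_notN offCA; rewrite addr_eq0 => /eqP zE.
  apply: (@sub_join _ _ _ _ ((y + x) / 2) ((y - x) / 2)).
  by rewrite !baryZ baryD zE; congr bary; field.
- apply: contra_notN offAB; rewrite addr_eq0 => /eqP xE.
  apply: (@sub_join _ _ _ _ ((z + y) / 2) ((z - y) / 2)).
  by rewrite !baryZ baryD xE; congr bary; field.
Qed.

Lemma off_medians_bary A B C x y z :
  off_medians A B C <[bary A B C x y z]>%VS ->
  [/\ x != y, y != z & z != x].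
Proof.
rewrite /off_medians /pt -!/(homog (centroid _ _ _)) bary_centroid.
rewrite -/(homog A) -/(homog B) -/(homog C).
rewrite (bary1 A B C) (bary2 A B C) (bary3 A B C).
case=> offA offB offC; split.
(* The median through C is x = y, where the vector of P is (z - y) C + 3y G; the other two are its
   rotations. *)
- apply: contra_notN offC => /eqP xE.
  apply: (@sub_join _ _ _ _ (z - y) (3 * y)).
  by rewrite !baryZ baryD xE; congr bary; field.
- apply: contra_notN offA => /eqP yE.
  apply: (@sub_join _ _ _ _ (x - z) (3 * z)).
  by rewrite !baryZ baryD yE; congr bary; field.
- apply: contra_notN offB => /eqP zE.
  apply: (@sub_join _ _ _ _ (y - x) (3 * x)).
  by rewrite !baryZ baryD zE; congr bary; field.
Qed.

Lemma steiner_bary A B C x y z : triangle A B C ->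
  x != 0 -> y != 0 -> z != 0 -> x * y + y * z + z * x = 0 ->
  on_steiner_circumellipse A B C <[bary A B C x y z]>%VS.
Proof.
move=> tri x0 y0 z0 s20.
have yz0 : y * z != 0 by rewrite mulf_neq0.
have zx0 : z * x != 0 by rewrite mulf_neq0.
have xy0 : x * y != 0 by rewrite mulf_neq0.
exists <[bary A B C (y * z) (z * x) (x * y)]>%VS; split.
- by apply: point_bary; rewrite // yz0.
- by rewrite sub_l_inf weight_bary -s20; apply/eqP; ring.
(* The witness is the isotomic conjugate of P, of weight t = 0. Conjugating it again multiplies the
   triple (x, y, z) by xyz. *)
have -> : <[bary A B C x y z]>%VS =
    <[bary A B C (z * x * (x * y)) (x * y * (y * z)) (y * z * (z * x))]>%VS.
  apply/esym/(@vline_scale _ _ _ (x * y * z)); first by rewrite !mulf_neq0.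
  by rewrite baryZ; congr bary; ring.
exact: isotomic_bary.
Qed.

(** * The intersection points V and S *)

Section Collinearities.
Variables (A B C : 'rV[R]_2) (x y z : R).
Hypotheses (tri : triangle A B C) (x0 : x != 0) (y0 : y != 0) (z0 : z != 0).
Hypotheses (a0 : y + z != 0) (b0 : z + x != 0) (c0 : x + y != 0).
Hypotheses (s10 : x + y + z != 0) (s20 : x * y + y * z + z * x != 0).
Hypothesis vdm0 : (x - y) * (y - z) * (z - x) != 0.
Local Notation pnt p q r := (<[bary A B C p q r]>%VS).
Local Notation s1 := (x + y + z).
Local Notation s2 := (x * y + y * z + z * x).
Local Notation d := ((y + z) * (z + x) * (x + y)).
Local Notation P := (pnt x y z).
Local Notation P' := (pnt (y * z) (z * x) (x * y)).
Local Notation Q := (pnt (x * (y + z)) (y * (z + x)) (z * (x + y))).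
Local Notation Q' := (pnt (y + z) (z + x) (x + y)).
Local Notation O := (<[circumcenter_bary A B C x y z]>%VS).
Local Notation O' := (<[circumcenter_bary A B C (y * z) (z * x) (x * y)]>%VS).
Local Notation V := (pnt (x * (s1 * (y + z) - s2)) (y * (s1 * (z + x) - s2))
  (z * (s1 * (x + y) - s2))).
Local Notation S := (pnt (x * (y + z) ^+ 2) (y * (z + x) ^+ 2)
  (z * (x + y) ^+ 2)).

Let xy0 : x - y != 0.
Proof. by move: vdm0; rewrite !mulf_eq0 !negb_or -andbA => /and3P[]. Qed.

Let two0 : 2 != 0 :> R. Proof. by rewrite pnatr_eq0. Qed.

Let third0 : 3^-1 != 0 :> R. Proof. by rewrite invr_eq0 pnatr_eq0. Qed.

Let dP : is_point P. Proof. by apply: point_bary; rewrite ?x0. Qed.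

Let dQ : is_point Q. Proof. by apply: point_bary; rewrite ?mulf_neq0. Qed.

Let dS : is_point S.
Proof. by apply: point_bary; rewrite ?mulf_neq0 ?expf_neq0. Qed.

Let dV : is_point V.
Proof.
apply: point_weight; rewrite weight_bary.
by rewrite [X in X != 0](_ : _ = s1 * s2) ?mulf_neq0 //; ring.
Qed.

Lemma line_OQ : is_line (O + Q)%VS.
Proof.
apply: line_add => //.
  by apply: point_weight; rewrite weight_circumcenter !mulf_neq0 // pnatr_eq0.
case/(eq_point_bary tri) => /eqP + _ _; apply/negP; rewrite -subr_eq0.
rewrite [X in X != 0](_ : _ =
    - (2 * s2 * (x * y) * ((y + z) * (z + x)) * (x - y))).
  by rewrite oppr_eq0 !mulf_neq0.
by rewrite /circumcenter_coord; ring.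
Qed.

Lemma meet_PQ_P'Q' : is_meet V (P + Q)%VS (P' + Q')%VS.
Proof.
apply: meet_point.
- apply: line_add => // /(eq_point_bary tri)[/eqP + _ _]; apply/negP.
  rewrite -subr_eq0 [X in X != 0](_ : _ = x * y * (x - y)); last by ring.
  by rewrite !mulf_neq0.
- apply: line_add; first by apply: point_bary; rewrite ?mulf_neq0.
    by apply: point_bary; rewrite ?a0.
  move=> /(eq_point_bary tri)[/eqP + _ _]; apply/negP.
  rewrite -subr_eq0 [X in X != 0](_ : _ = - (z * z * (x - y))); last by ring.
  by rewrite oppr_eq0 !mulf_neq0.
(* P' is off PQ: the determinant of P, Q, P' is -s2 times the product of the differences of x, y,
   z. *)
- move=> eql; have: (P' <= P + Q)%VS by rewrite eql addvSl.
  move/(sub_join_bary tri)/eqP; apply/negP.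
  rewrite [X in X != 0](_ : _ = - (s2 * ((x - y) * (y - z) * (z - x)))).
    by rewrite oppr_eq0 mulf_neq0.
  by ring.
- exact: dV.
(* As vectors, V = s1 Q - s2 P = s2 Q' - s1 P'. *)
- apply: (@sub_join _ _ _ _ (- s2) s1).
  by rewrite !(baryZ, baryD); congr bary; ring.
- apply: (@sub_join _ _ _ _ (- s1) s2).
  by rewrite !(baryZ, baryD); congr bary; ring.
Qed.

Lemma meet_OQ_GV :
  is_meet S (O + Q)%VS (pt (centroid A B C) + V)%VS.
Proof.
rewrite /pt -/(homog _) bary_centroid.
apply: meet_point => //; first exact: line_OQ.
- apply: line_add; [by apply: point_bary; rewrite ?third0|exact: dV|].
  case/(eq_point_bary tri) => /(mulfI third0) e12 /(mulfI third0) e23 _.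
  (* If V were G, its coordinates would be equal, giving s1 z = s2 = s1 x, whereas s1 and z - x are
     nonzero. *)
  have e12' : (y - x) * (s1 * z - s2) = 0.
    by move/eqP: e12; rewrite -subr_eq0 => /eqP <-; ring.
  have e23' : (z - y) * (s1 * x - s2) = 0.
    by move/eqP: e23; rewrite -subr_eq0 => /eqP <-; ring.
  have := mulf_neq0 s10 vdm0.
  rewrite [X in X != 0](_ : _ = (z - y) * ((y - x) * (s1 * z - s2))
      - (y - x) * ((z - y) * (s1 * x - s2))); last by ring.
  by rewrite e12' e23' !mulr0 subrr eqxx.
- move=> eql; have: (pnt 3^-1 3^-1 3^-1 <= O + Q)%VS by rewrite eql addvSl.
  move/(sub_join_bary tri)/eqP; apply/negP.
  rewrite [X in X != 0](_ : _ =
      2 / 3 * s2 ^+ 2 * ((x - y) * (y - z) * (z - x))).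
    by apply: mulf_neq0 vdm0; rewrite !mulf_neq0 ?expf_neq0 ?third0.
  by rewrite /circumcenter_coord; field.
(* This solves O = 2 s2 S - d Q for S. *)
- apply: (@sub_join _ _ _ _ (2 * s2)^-1 (d / (2 * s2))).
  rewrite !(baryZ, baryD) /circumcenter_coord.
  by congr bary; field; rewrite ?s20.
(* S = V + xyz (1, 1, 1), and the vector of G has coordinates 1/3, whence the factor 3. *)
- apply: (@sub_join _ _ _ _ (3 * (x * y * z)) 1).
  by rewrite !(baryZ, baryD); congr bary; field.
Qed.

Lemma meet_OQ_O'Q' : is_meet S (O + Q)%VS (O' + Q')%VS.
Proof.
(* At (yz, zx, xy) the circumcenter formula has the common factor (xyz)^2; removing it leaves 2 s1 S
   - d Q', which is solved for S below. *)
have -> : O' = pnt ((y + z) * (2 * s1 * x * (y + z) - d))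
    ((z + x) * (2 * s1 * y * (z + x) - d))
    ((x + y) * (2 * s1 * z * (x + y) - d)).
  apply: (@vline_scale _ _ _ ((x * y * z) ^+ 2)).
    by rewrite expf_neq0 // !mulf_neq0.
  rewrite baryZ /circumcenter_bary /circumcenter_coord.
  by congr bary; ring.
apply: meet_point => //; first exact: line_OQ.
- apply: line_add.
  + apply: point_weight; rewrite weight_bary.
    rewrite [X in X != 0](_ : _ = 8 * s1 * (x * y * z)); last by ring.
    by rewrite !mulf_neq0 // pnatr_eq0.
  + by apply: point_bary; rewrite ?a0.
  move=> /(eq_point_bary tri)[/eqP + _ _]; apply/negP.
  rewrite -subr_eq0 [X in X != 0](_ : _ =
      2 * s1 * (y + z) * (z + x) * z * (x - y)); last by ring.
  by rewrite !mulf_neq0.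
- move=> eql; have: (Q' <= O + Q)%VS by rewrite eql addvSr.
  move/(sub_join_bary tri)/eqP; apply/negP.
  rewrite [X in X != 0](_ : _ = 2 * s2 * d * ((x - y) * (y - z) * (z - x))).
    by apply: mulf_neq0 vdm0; rewrite !mulf_neq0.
  by rewrite /circumcenter_coord; ring.
- apply: (@sub_join _ _ _ _ (2 * s2)^-1 (d / (2 * s2))).
  rewrite !(baryZ, baryD) /circumcenter_coord.
  by congr bary; field; rewrite ?s20.
- apply: (@sub_join _ _ _ _ (2 * s1)^-1 (d / (2 * s1))).
  by rewrite !(baryZ, baryD); congr bary; field; rewrite ?s10.
Qed.

End Collinearities.
End Circumcenter.

Theorem theorem3p9 (R : realType) (A B C : 'rV[R]_2)
    (P P' O O' : subspace R) (TP TP' : affine_map R)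
    (K := complement_map A B C)
    (G := pt (centroid A B C))
    (Q := aff_act K P') (Q' := aff_act K P)
    (V := ((P + Q) :&: (P' + Q'))%VS)
    (M := aff_comp TP (aff_comp (aff_inv K) TP'))
    (tri_ABC : triangle A B C)
    (P_off_sides : off_sides A B C P)
    (P_off_anticomplementary_sides :
       off_sides (aff_app (aff_inv K) A) (aff_app (aff_inv K) B)
         (aff_app (aff_inv K) C) P)
    (P_ordinary : ordinary P)
    (P_off_medians : off_medians A B C P)
    (P_off_steiner : ~ on_steiner_circumellipse A B C P)
    (P'_isotomic : is_isotomic_conjugate A B C P P')
    (TP_spec : maps_triangle TP A B C
       (trace A B C P) (trace B C A P) (trace C A B P))
    (TP'_spec : maps_triangle TP' A B C
       (refl_trace A B C P) (refl_trace B C A P) (refl_trace C A B P))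
    (O_circumcenter : is_generalized_circumcenter A B C P O)
    (O'_circumcenter : is_generalized_circumcenter A B C P' O') :
  exists S : subspace R,
    [/\ is_center M S,
        is_meet S (O + Q)%VS (G + V)%VS
      & is_meet S (O + Q)%VS (O' + Q')%VS].
Proof.
have [dP /negP P_fin] := P_ordinary; have [u _ PE] := point_vline dP.
have [x [y [z uE]]] := bary_surj tri_ABC u; rewrite {}uE in PE; subst P.
rewrite sub_l_inf weight_bary in P_fin.
have [x0 y0 z0] := off_sides_bary P_off_sides.
have [a0 b0 c0] := off_anticomplementary_bary P_off_anticomplementary_sides.
have [xy yz zx] := off_medians_bary P_off_medians.
have vdm0 : (x - y) * (y - z) * (z - x) != 0 by rewrite !mulf_neq0 ?subr_eq0.
have s20 : x * y + y * z + z * x != 0.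
  by apply: contra_notN P_off_steiner => /eqP; apply: steiner_bary.
have P'E := isotomic_unique tri_ABC x0 y0 z0 P'_isotomic; subst P'.
have OE := circumcenterE tri_ABC x0 y0 z0 s20 O_circumcenter; subst O.
(* This is t evaluated at P'. It equals xyz s, nonzero because P is ordinary, so the circumcenter
   formula also applies to P'. *)
have s20' : y * z * (z * x) + z * x * (x * y) + x * y * (y * z) != 0.
  rewrite [X in X != 0](_ : _ = x * y * z * (x + y + z)); last by ring.
  by rewrite !mulf_neq0.
have O'E := circumcenterE tri_ABC (mulf_neq0 y0 z0) (mulf_neq0 z0 x0)
  (mulf_neq0 x0 y0) s20' O'_circumcenter; subst O'.
rewrite trace_bary // trace_bary2 // trace_bary3 // in TP_spec.
rewrite refl_trace_bary // refl_trace_bary2 // refl_trace_bary3 // in TP'_spec.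
have ME := cevian_product_bary tri_ABC x0 y0 z0 a0 b0 c0 TP_spec TP'_spec.
have QE : Q = <[bary A B C (x * (y + z)) (y * (z + x)) (z * (x + y))]>%VS.
  by rewrite /Q complement_bary; congr (<[bary _ _ _ _ _ _]>)%VS; ring.
have Q'E : Q' = <[bary A B C (y + z) (z + x) (x + y)]>%VS.
  exact: complement_bary.
have [_ _ _ VE] :=
  meet_PQ_P'Q' tri_ABC x0 y0 z0 a0 b0 c0 P_fin s20 vdm0.
rewrite -QE -Q'E -/V in VE.
pose d := (y + z) * (z + x) * (x + y).
exists <[bary A B C (x * (y + z) ^+ 2) (y * (z + x) ^+ 2)
  (z * (x + y) ^+ 2)]>%VS; split.
(* The formula for M contains S/d, so this representative of the point S is the one passed to
   [center_sub]. *)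
- have d0 : d^-1 != 0 by rewrite invr_eq0 !mulf_neq0.
  rewrite -(@vline_scale _ (d^-1 *: _) _ _ d0 erefl).
  apply: center_sub ME _ _.
    by rewrite !mulf_neq0 ?oppr_eq0 ?pnatr_eq0.
  rewrite scaler_eq0 negb_or d0; apply/eqP => /(bary_eq0 tri_ABC)[/eqP + _ _].
  by apply/negP; rewrite mulf_neq0 ?expf_neq0.
- rewrite -VE QE.
  exact: meet_OQ_GV tri_ABC x0 y0 z0 a0 b0 c0 P_fin s20 vdm0.
- rewrite QE Q'E.
  exact: meet_OQ_O'Q' tri_ABC x0 y0 z0 a0 b0 c0 P_fin s20 vdm0.
Qed.
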